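(* Let $n\ge 3$ and let $S(n)$ be the minimum size of a P-encoding with $n$ input variables. Then: (1) if $n\le 8$, then $S(n)=3n-6$; (2) if $n\ge 9$, then $S(n)\ge 2n+\sqrt{n}-2$.
   Context: A CNF formula is a conjunction of clauses (disjunctions of literals with no complementary pair); its size is its number of clauses. Unit resolution: from a unit clause $l$ and a clause containing $\neg l$ derive the clause with $\neg l$ removed; $\varphi\wedge g\vdash_1 h$ means the literal $h$ is derivable from $\varphi$ and the unit clause $g$ by a sequence of unit resolutions. A CNF formula $\varphi(\mathbf{x},\mathbf{y})$ with input variables $x_1,\dots,x_n$ ($n\ge1$) and auxiliary variables $\mathbf{y}$ is a P-encoding if (P1) $\varphi\wedge x_i$ is satisfiable for each $i$, and (P2) $\varphi\wedge x_i\vdash_1\neg x_j$ for all $i\neq j$. *)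

(* Defs.v *)
From mathcomp Require Import all_boot all_order all_algebra.
From mathcomp Require Import boolp reals.

Set Implicit Arguments.
Unset Strict Implicit.
Unset Printing Implicit Defensive.

Section CNF.
Variable V : finType.

(* The literal (v, true) is v, and (v, false) is the negation of v. *)
Definition literal : Type := (V * bool)%type.
Definition pos (v : V) : literal := (v, true).
Definition neg (v : V) : literal := (v, false).
Definition compl (l : literal) : literal := (l.1, ~~ l.2).

Definition clause : Type := {set V * bool}.
Definition wf_clause (C : clause) : Prop :=
  forall l : literal, l \in C -> compl l \notin C.

(* Formulas are sets of clauses, so #|phi| is the number of clauses. *)
Definition formula : Type := {set {set V * bool}}.
Definition is_CNF (phi : formula) : Prop :=
  forall C : clause, C \in phi -> wf_clause C.

(* phi /\ g, with the literal g read as a unit clause *)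
Definition add_unit (phi : formula) (g : literal) : formula :=
  [set g] |: phi.

Definition true_literal (a : V -> bool) (l : literal) : Prop := a l.1 = l.2.
Definition satisfies (a : V -> bool) (phi : formula) : Prop :=
  forall C : clause, C \in phi -> exists2 l : literal, l \in C & true_literal a l.
Definition satisfiable (phi : formula) : Prop :=
  exists a : V -> bool, satisfies a phi.

Inductive unit_derivable (phi : formula) : clause -> Prop :=
| UD_axiom (C : clause) : C \in phi -> unit_derivable phi C
| UD_resolve (l : literal) (C : clause) :
    unit_derivable phi [set l] -> unit_derivable phi C -> compl l \in C ->
    unit_derivable phi (C :\ compl l).

Definition unit_entails (phi : formula) (g h : literal) : Prop :=
  unit_derivable (add_unit phi g) [set h].

End CNF.

(* n input variables (left summand) and m auxiliary variables *)
Definition var (n m : nat) : finType := ('I_n + 'I_m)%type.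
Definition input (n m : nat) (i : 'I_n) : var n m := inl i.

Definition P_encoding (n m : nat) (phi : formula (var n m)) : Prop :=
  [/\ is_CNF phi,
      forall i : 'I_n, satisfiable (add_unit phi (pos (input m i)))
    & forall i j : 'I_n, i != j ->
        unit_entails phi (pos (input m i)) (neg (input m j))].

Definition P_encoding_size (n s : nat) : Prop :=
  exists (m : nat) (phi : formula (var n m)), P_encoding phi /\ #|phi| = s.

(* Witness: the clauses (~ x_i \/ ~ x_j) for i != j. *)
Lemma P_encoding_size_exists (n : nat) : exists s : nat, `[< P_encoding_size n s >].
Proof.
pose cl (p : 'I_n * 'I_n) : {set var n 0 * bool} :=
  [set neg (input 0 p.1); neg (input 0 p.2)].
pose phi : formula (var n 0) := [set cl p | p in [pred p | p.1 != p.2]].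
exists #|phi|; apply/asboolP; exists 0, phi; split=> //; split.
- move=> _ /imsetP[p _ ->] l; rewrite !inE => /orP[] /eqP ->;
  by rewrite /compl /neg !xpair_eqE !andbF.
- move=> i; exists (pred1 (input 0 i)) => C.
  rewrite !inE => /orP[/eqP->|/imsetP[[j k] /= jk ->]].
    by exists (pos (input 0 i)); rewrite ?inE // /true_literal /= eqxx.
  have [ji|ji] := eqVneq j i.
    exists (neg (input 0 k)); first by rewrite !inE eqxx orbT.
    by apply/negbTE; rewrite /= -ji eq_sym; move: jk; rewrite inE.
  exists (neg (input 0 j)); first by rewrite !inE eqxx.
  exact/negbTE.
- move=> i j ij; rewrite /unit_entails.
  have -> : [set neg (input 0 j)] =
      cl (i, j) :\ compl (pos (input 0 i)) :> {set var n 0 * bool}.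
    apply/setP=> l; rewrite !inE /=.
    have [->|//] := eqVneq l (neg (input 0 i)).
    rewrite /neg xpair_eqE eqxx andbT /=.
    by apply/negbTE.
  apply: UD_resolve.
  + by apply: UD_axiom; rewrite !inE eqxx.
  + apply: UD_axiom; rewrite !inE; apply/orP; right.
    by apply/imsetP; exists (i, j).
  + by rewrite !inE eqxx.
Qed.

Definition min_P_size (n : nat) : nat := ex_minn (P_encoding_size_exists n).

(* Main.v *)
(* Lower bound.  If some ~x_i occurs in at least three clauses, setting x_i to
   false leaves an encoding of n - 1 inputs with three clauses fewer.  If ~x_i
   occurs in a single clause, another literal of that clause can be substituted
   for x_i, which saves the clause.  Hence assume that every ~x_i occurs exactly
   twice.  If ~x_i and ~x_j share a clause, setting x_j to false and then
   substituting for x_i again saves three clauses and one input.  Otherwise 2n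
   clauses contain a negated input and q do not.  Choose in each of the two
   clauses of ~x_i a literal that is true in a model of phi /\ x_i.  Besides
   these two literals and the negated inputs, x_i propagates at most q literals,
   and for each j <> i they falsify one of the two literals chosen for x_j.
   Inputs sharing a chosen literal must exclude each other through their second
   literals, so at most q + 1 of them (two if q = 0) share one; therefore
   n - 1 <= (q + 2)(q + 1), respectively n <= 5.

   Upper bound.  The inputs 0 .. k are summarised by a chain of literals, each
   step of which costs three clauses. *)
Require Import Defs.
From mathcomp Require Import all_boot all_order all_algebra.
From mathcomp Require Import boolp reals zify.

Set Implicit Arguments.
Unset Strict Implicit.
Unset Printing Implicit Defensive.
Import Order.TTheory GRing.Theory Num.Theory.

Lemma exists_third (T : finType) (A : {set T}) (i j : T) :
  2 < #|A| -> exists2 k, k \in A & (k != i) && (k != j).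
Proof.
move=> A3; have : 0 < #|A :\ i :\ j|.
  move: A3; rewrite (cardsD1 i A) (cardsD1 j (A :\ i)).
  by case: (i \in A); case: (j \in _); case: #|_|.
by case/card_gt0P=> k; rewrite !inE => /and3P[kj ki kA]; exists k; rewrite ?ki ?kj.
Qed.

(** * Unit propagation on literals, and restriction of formulas *)

Section Propagation.
Variable V : finType.
Implicit Types (g h l t : literal V) (phi : formula V) (C D : clause V).
Implicit Types (a : V -> bool).

Definition holds a l : bool := a l.1 == l.2.

Lemma complK : involutive (@compl V).
Proof. by case=> v b; rewrite /compl /= negbK. Qed.

Lemma compl_inj : injective (@compl V).
Proof. exact: can_inj complK. Qed.

Lemma holds_compl a l : holds a (compl l) = ~~ holds a l.
Proof. by rewrite /holds /compl /=; case: (a _); case: (l.2). Qed.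

Lemma compl_neq l : compl l != l.
Proof. by case: l => v b; rewrite xpair_eqE eqxx; case: b. Qed.

Lemma satisfiesP a phi :
  satisfies a phi <-> forall C, C \in phi -> exists2 l, l \in C & holds a l.
Proof.
by split=> H C /H [l lC al]; exists l => //; apply/eqP.
Qed.

(** Keeps no partially resolved clauses, so propagation can be followed literal by literal through
    restrictions and substitutions. *)
Inductive derives phi g : literal V -> Prop :=
| derives_start : derives phi g g
| derives_clause C l : C \in phi -> l \in C ->
    (forall l', l' \in C -> l' != l -> derives phi g (compl l')) ->
    derives phi g l.

(** Invariant: every derivable clause lies in a clause of [add_unit phi g] whose remaining literals
    are all refuted. *)
Lemma unit_entails_derives phi g h : unit_entails phi g h -> derives phi g h.
Proof.
suff base l0 : (exists2 C, C \in add_unit phi g & [set l0] \subset C /\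
    forall l, l \in C -> l \notin [set l0] -> derives phi g (compl l)) ->
    derives phi g l0.
  move=> H; apply: (base h).
  elim: H => {h} [C Cphi|l D _ /base dl _ [C Cphi [sDC dC]] lD].
    by exists C => //; split=> // l ->.
  exists C => //; split; first exact: subset_trans (subsetDl _ _) sDC.
  move=> l' l'C; rewrite !inE negb_and negbK => /orP[/eqP->|l'D].
    by rewrite complK.
  exact: dC.
case=> C; rewrite !inE => /orP[/eqP->|Cphi] [].
  by rewrite sub1set inE => /eqP-> _; apply: derives_start.
rewrite sub1set => lC dC; apply: derives_clause Cphi lC _ => l l'C ll0.
by apply: dC; rewrite ?inE.
Qed.

Lemma derives_sound phi g l a :
  satisfies a phi -> holds a g -> derives phi g l -> holds a l.
Proof.
move=> /satisfiesP sat ag; elim=> {l} // C l /sat[l' l'C al'] lC _ IH.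
have [<- //|l'l] := eqVneq l' l.
by move: (IH _ l'C l'l); rewrite holds_compl al'.
Qed.

(* A tautological clause can only derive a literal that is already derived. *)
Lemma derivesP phi g l : derives phi g l ->
  l = g \/ exists C, [/\ C \in phi, l \in C, compl l \notin C &
    forall l', l' \in C -> l' != l -> derives phi g (compl l')].
Proof.
elim=> {l} [|C l Cphi lC dC IH]; first by left.
case: (boolP (compl l \in C)) => [clC|ncl]; last by right; exists C.
by have := IH _ clC (compl_neq l); rewrite complK.
Qed.

Definition assign t phi : formula V :=
  [set C :\ compl t | C in [set C in phi | t \notin C]].

Lemma satisfies_assign a t phi :
  satisfies a phi -> holds a t -> satisfies a (assign t phi).
Proof.
move=> /satisfiesP sat at_; apply/satisfiesP => D /imsetP[C]; rewrite inE.
case/andP=> /sat[l lC al] _ ->; exists l => //; rewrite !inE lC andbT.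
by apply: contraTneq al => ->; rewrite holds_compl at_.
Qed.

(** The model makes every derived literal true, so a clause containing [t] can derive nothing but
    [t]; all other steps survive the restriction. *)
Lemma derives_assign a t phi g l :
    satisfies a phi -> holds a g -> holds a t -> derives phi g l ->
  l = t \/ derives (assign t phi) g l.
Proof.
move=> sat ag at_; elim=> {l} [|C l Cphi lC dC IH]; first by right; left.
have [->|lt] := eqVneq l t; [by left | right].
have al : holds a l by apply: derives_sound sat ag _; apply: derives_clause dC.
have tC : t \notin C.
  apply/negP=> tC; have := derives_sound sat ag (dC _ tC _).
  by rewrite holds_compl at_ eq_sym => /(_ lt).
apply: (@derives_clause _ _ (C :\ compl t)).
- by apply/imsetP; exists C => //; rewrite inE Cphi.
- by rewrite !inE lC andbT; apply: contraTneq al => ->; rewrite holds_compl at_.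
- move=> l'; rewrite !inE => /andP[l't l'C] l'l.
  case: (IH _ l'C l'l) => // e; move: l't.
  by rewrite -e complK eqxx.
Qed.

Definition occ phi t : {set clause V} := [set C in phi | t \in C].

Lemma occ_sub phi t : occ phi t \subset phi.
Proof. by apply/subsetP=> C; rewrite inE => /andP[]. Qed.

Lemma card_assign t phi : #|assign t phi| + #|occ phi t| <= #|phi|.
Proof.
rewrite -(cardsID (occ phi t) phi) addnC.
have /setIidPr -> := occ_sub phi t; rewrite leq_add2l.
apply: leq_trans (leq_imset_card _ _) _; apply: subset_leq_card.
by apply/subsetP=> C; rewrite !inE => /andP[-> /negbTE->].
Qed.

End Propagation.

(** * Encodings: dropping an input, saving a clause *)

(* Inputs are arbitrary literals, and only those with index in [A] are active:
   this makes the restrictions and substitutions below leave [V] and [I] fixed. *)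
Section Encoding.
Variables (V I : finType).
Implicit Types (x : I -> literal V) (phi : formula V) (A : {set I}).
Implicit Types (i j k : I).

Record encoding A x phi : Prop := Encoding {
  encoding_sat : forall i, i \in A ->
    exists2 a, satisfies a phi & holds a (x i);
  encoding_derives : forall i j, i \in A -> j \in A -> i != j ->
    derives phi (x i) (compl (x j)) }.

Section Basics.
Variables (A : {set I}) (x : I -> literal V) (phi : formula V).
Hypothesis enc : encoding A x phi.

Lemma encoding_holdsN a i j : satisfies a phi -> holds a (x i) ->
  i \in A -> j \in A -> i != j -> ~~ holds a (x j).
Proof.
move=> sat ai iA jA ij; rewrite -holds_compl.
exact: derives_sound sat ai (encoding_derives enc iA jA ij).
Qed.

Lemma encoding_consistent i l :
  i \in A -> derives phi (x i) l -> derives phi (x i) (compl l) -> False.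
Proof.
move=> iA d1 d2; have [a sat ai] := encoding_sat enc iA.
have := derives_sound sat ai d2; rewrite holds_compl.
by rewrite (derives_sound sat ai d1).
Qed.

Lemma encoding_inj i j : i \in A -> j \in A -> i != j -> x i != x j.
Proof.
move=> iA jA ij; have [a sat ai] := encoding_sat enc iA.
by apply: contraNneq (encoding_holdsN sat ai iA jA ij) => <-.
Qed.

(** Otherwise a third input would derive both [x j] and its complement. *)
Lemma encoding_neq_compl i j :
  2 < #|A| -> i \in A -> j \in A -> i != j -> x i != compl (x j).
Proof.
move=> A3 iA jA ij; apply/eqP=> e.
have [k kA /andP[ki kj]] := exists_third i j A3.
have dj := encoding_derives enc kA jA kj.
by apply: (encoding_consistent kA) dj _; rewrite -e; apply: (encoding_derives enc).
Qed.

Lemma encoding_restrict j :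
  j \in A -> encoding (A :\ j) x (assign (compl (x j)) phi).
Proof.
move=> jA; split=> [i|i k]; rewrite !inE.
  case/andP=> ij iA; have [a sat ai] := encoding_sat enc iA; exists a => //.
  apply: (satisfies_assign sat); rewrite holds_compl.
  exact: encoding_holdsN sat ai iA jA ij.
case/andP=> ij iA /andP[kj kA] ik; have [a sat ai] := encoding_sat enc iA.
have aj : holds a (compl (x j)).
  by rewrite holds_compl; apply: encoding_holdsN sat ai iA jA ij.
have [/compl_inj e|//] :=
  derives_assign sat ai aj (encoding_derives enc iA kA ik).
by have := encoding_inj kA jA kj; rewrite e eqxx.
Qed.

(** [C] is the last clause used in deriving [compl (x j)] from [x i]. A further [compl (x k)] in it
    would have to be refuted, but [x i] excludes [x k]. *)
Lemma encoding_clause i j : 2 < #|A| -> i \in A -> j \in A -> i != j ->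
  exists C, [/\ C \in phi, compl (x j) \in C, x j \notin C,
    forall k, k \in A -> k != i -> k != j -> compl (x k) \notin C &
    forall l, l \in C -> l != compl (x j) -> derives phi (x i) (compl l)].
Proof.
move=> A3 iA jA ij; case: (derivesP (encoding_derives enc iA jA ij)) => [e|].
  by have := encoding_neq_compl A3 iA jA ij; rewrite e eqxx.
case=> C; rewrite complK => -[Cphi jC njC dC]; exists C; split=> // k kA ki kj.
apply/negP=> kC; apply: (@encoding_consistent i (x k)) => //.
  rewrite -[x k]complK; apply: dC => //.
  by rewrite (inj_eq (@compl_inj V)); apply: encoding_inj.
by apply: (encoding_derives enc); rewrite // eq_sym.
Qed.

(** A clause through which [x i] excludes [x j] avoids [compl (x k)], so it comes on top of the two
    clauses of [compl (x k)]. This settles the case of three inputs. *)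
Lemma encoding_card_gt2 : 2 < #|A| ->
  (forall i, i \in A -> 1 < #|occ phi (compl (x i))|) -> 2 < #|phi|.
Proof.
move=> A3 occ2; have /card_gt0P[i iA] : 0 < #|A| by lia.
have [j jA /andP[ji _]] := exists_third i i A3.
have [k kA /andP[ki kj]] := exists_third i j A3.
rewrite eq_sym in ji; have [C [Cphi _ _ H _]] := encoding_clause A3 iA jA ji.
apply: leq_ltn_trans (occ2 k kA) _; apply: proper_card; apply/properP.
split; first exact: occ_sub.
by exists C => //; rewrite !inE Cphi /= H.
Qed.

(* The only clause [C] through which [x i] can propagate has a literal [t] that
   is true together with [x i]; then [t] can play the role of [x i]. *)
Lemma encoding_shrink i : 2 < #|A| -> i \in A ->
    #|occ phi (compl (x i))| <= 1 ->
  exists x' phi', encoding A x' phi' /\ #|phi'| < #|phi|.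
Proof.
move=> A3 iA occ1; have [j jA /andP[ji _]] := exists_third i i A3.
have [C [Cphi iC niC _ _]] := encoding_clause A3 jA iA ji.
have Cuniq D : D \in phi -> compl (x i) \in D -> D = C.
  move=> Dphi iD; have/card_le1_eqP := occ1; apply; by rewrite inE ?Cphi ?Dphi.
have [ai sati aii] := encoding_sat enc iA.
have [t tC ait] : exists2 t, t \in C & holds ai t.
  by have /satisfiesP := sati; apply.
have tNi : t != compl (x i).
  by apply: contraTneq ait => ->; rewrite holds_compl aii.
have ti : t != x i by apply: contraNneq niC => <-.
(* Substitution of [t] for [x i]. The complement of [x i] needs no substitute, as it occurs only in
   the deleted clause [C]. *)
pose s (D : clause V) : clause V := if x i \in D then t |: (D :\ x i) else D.
pose phi' : formula V := [set s D | D in phi :\ C].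
pose x' k := if k == i then t else x k.
have sphi D : D \in phi -> compl (x i) \notin D -> s D \in phi'.
  move=> Dphi iD; apply/imsetP; exists D => //; rewrite !inE Dphi andbT.
  by apply: contraNneq iD => ->.
(* Since [t] is true in [ai], [C] can derive only [t], which is now the starting literal. *)
have from_t l : derives phi (x i) l -> l = x i \/ derives phi' t l.
  elim=> {l} [|D l Dphi lD dD IH]; first by left.
  have dl : derives phi (x i) l by apply: derives_clause dD.
  have [->|li] := eqVneq l (x i); [by left | right].
  have [DC|DC] := eqVneq D C.
    have [->|lt] := eqVneq l t; first exact: derives_start.
    have := derives_sound sati aii (dD t _ _).
    by rewrite holds_compl ait DC eq_sym tC lt; move=> /(_ isT isT).
  have iD : compl (x i) \notin D by apply: contraNN DC => /(Cuniq _ Dphi) ->.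
  have niD : x i \notin D.
    apply/negP=> niD; have := derives_sound sati aii (dD _ niD _).
    by rewrite holds_compl aii eq_sym => /(_ li).
  apply: (@derives_clause _ _ _ D) => //.
    by have := sphi _ Dphi iD; rewrite /s (negbTE niD).
  move=> l' l'D l'l; case: (IH _ l'D l'l) => // e.
  by rewrite -e complK l'D in iD.
(* From another input, [C] can derive only [compl (x i)], and only after [compl t], which takes its
   place. *)
have from_x k l : k \in A -> k != i -> derives phi (x k) l ->
    derives phi' (x k) (if l == compl (x i) then compl t else l).
  move=> kA ki; have cons := encoding_consistent kA.
  have dki := encoding_derives enc kA iA ki.
  elim=> {l} [|D l Dphi lD dD IH].
    by rewrite (negbTE (encoding_neq_compl A3 kA iA ki)); apply: derives_start.
  have dl : derives phi (x k) l by apply: derives_clause dD.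
  have [DC|DC] := eqVneq D C.
    have [li|li] := eqVneq l (compl (x i)).
      have := IH t; rewrite DC tC li tNi => /(_ isT isT).
      by rewrite (inj_eq (@compl_inj V)) (negbTE ti).
    case: (@cons (x i)) => //; rewrite -[x i]complK; apply: dD.
      by rewrite DC.
    by rewrite eq_sym.
  have iD : compl (x i) \notin D by apply: contraNN DC => /(Cuniq _ Dphi) ->.
  have -> : (l == compl (x i)) = false.
    by apply: contraNF iD => /eqP <-.
  have li : l != x i by apply/eqP=> e; apply: (@cons (x i)); rewrite // -e.
  apply: (@derives_clause _ _ _ (s D)); first exact: sphi.
    by rewrite /s; case: ifP => //; rewrite !inE li lD orbT.
  move=> l' l's l'l; case: (boolP (x i \in D)) => niD; last first.
    move: l's; rewrite /s (negbTE niD) => l'D; have := IH _ l'D l'l.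
    rewrite (inj_eq (@compl_inj V)); case: eqP => // e.
    by rewrite -e l'D in niD.
  move: l's; rewrite /s niD !inE => /orP[/eqP->|/andP[l'i l'D]].
    by have := IH _ niD; rewrite eqxx eq_sym li => /(_ isT).
  by have := IH _ l'D l'l; rewrite (inj_eq (@compl_inj V)) (negbTE l'i).
have sat' a : satisfies a phi -> holds a (x i) ==> holds a t ->
    satisfies a phi'.
  move=> /satisfiesP sat ait'; apply/satisfiesP => D' /imsetP[D]; rewrite !inE.
  case/andP=> _ /sat[l lD al] ->; rewrite /s; case: ifP => niD; last by exists l.
  have [li|li] := eqVneq l (x i); last by exists l; rewrite // !inE li lD orbT.
  by exists t; [rewrite !inE eqxx | apply: (implyP ait'); rewrite -li].
exists x', phi'; split; last first.
  apply: leq_ltn_trans (leq_imset_card _ _) _.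
  by rewrite (cardsD1 C phi) Cphi.
split=> [k kA|k1 k2 k1A k2A k12]; rewrite /x'.
  have [ki|ki] := eqVneq k i.
    by exists ai => //; apply: sat'; rewrite // ait implybT.
  have [a sat ak] := encoding_sat enc kA; exists a => //; apply: sat' => //.
  by rewrite (negbTE (encoding_holdsN sat ak kA iA ki)).
have [k1i|k1i] := eqVneq k1 i.
  rewrite -k1i eq_sym (negbTE k12) -/(x' k2).
  have ik2 : i != k2 by rewrite -k1i.
  have [e|//] := from_t _ (encoding_derives enc iA k2A ik2).
  by have := encoding_neq_compl A3 iA k2A ik2; rewrite e eqxx.
have := from_x k1 _ k1A k1i (encoding_derives enc k1A k2A k12).
rewrite (inj_eq (@compl_inj V)).
have [k2i|k2i] := eqVneq k2 i; first by rewrite k2i eqxx.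
by rewrite (negbTE (encoding_inj k2A iA k2i)).
Qed.

End Basics.
End Encoding.

(** * Counting inputs by shared chosen literals *)

(* The combinatorial core: input [i] triggers the two literals [g i b], and at
   most [q] further literals of [T i] are derived; each other input is excluded
   through one of its own two literals. *)
Section PairCounting.
Variables (V I : finType) (A : {set I}) (q : nat).
Variables (a : I -> V -> bool) (g : I -> bool -> literal V).
Variable (T : I -> {set V * bool}).
Implicit Types (i j : I) (h l : literal V).
Let rest i : {set V * bool} := T i :\: [set g i false; g i true].
Hypothesis g_holds : forall i b, i \in A -> holds (a i) (g i b).
Hypothesis T_holds : forall i l, i \in A -> l \in T i -> holds (a i) l.
Hypothesis T_hits : forall i j, i \in A -> j \in A -> i != j ->
  exists b, compl (g j b) \in T i.
Hypothesis card_rest : forall i, i \in A -> #|rest i| <= q.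

Let group h : {set I} := [set j in A | (g j false == h) || (g j true == h)].
Let other h j : literal V := if g j false == h then g j true else g j false.

Let groupA h i : i \in group h -> i \in A.
Proof. by rewrite inE => /andP[]. Qed.

Let pairE h i : i \in group h -> [set g i false; g i true] = [set h; other h i].
Proof.
rewrite inE /other => /andP[_]; case: eqP => [-> //|_ /= /eqP->].
by rewrite setUC.
Qed.

Let mem_pair h i b : i \in group h -> g i b = h \/ g i b = other h i.
Proof.
move=> /pairE e; have : g i b \in [set h; other h i].
  by rewrite -e !inE; case: b; rewrite eqxx ?orbT.
by rewrite !inE => /orP[]/eqP; [left | right].
Qed.

Let other_holds h i : i \in group h -> holds (a i) (other h i).
Proof.
by move=> /groupA iA; rewrite /other; case: ifP => _; apply: g_holds.
Qed.

Let group_holds h i : i \in group h -> holds (a i) h.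
Proof.
by rewrite inE => /andP[iA /orP[]/eqP<-]; apply: g_holds.
Qed.

(** As [h] is true in the model of [i], input [i] must exclude [j] through the second literal of
    [j]. *)
Let other_hit h i j : i \in group h -> j \in group h -> i != j ->
  compl (other h j) \in T i.
Proof.
move=> iG jG ij; have [b] := T_hits (groupA iG) (groupA jG) ij.
case: (mem_pair b jG) => [->|-> //] /(T_holds (groupA iG)).
by rewrite holds_compl group_holds.
Qed.

Let other_inj h : {in group h &, injective (other h)}.
Proof.
move=> i j iG jG e; apply/eqP; apply/negPn/negP=> ij.
have := T_holds (groupA iG) (other_hit iG jG ij).
by rewrite holds_compl -e other_holds.
Qed.

Let excluded h i : {set V * bool} := [set compl (other h j) | j in group h :\ i].

Let card_excluded h i : i \in group h -> #|excluded h i|.+1 = #|group h|.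
Proof.
move=> iG; rewrite card_in_imset; first by rewrite (cardsD1 i (group h)) iG.
move=> j k /setD1P[_ jG] /setD1P[_ kG] /compl_inj; exact: other_inj.
Qed.

(** An excluded literal is false in the model of some [j] in the group, where [h] is true. Hence it
    is not [h]. *)
Let excluded_sub h i : i \in group h -> excluded h i \subset other h i |: rest i.
Proof.
move=> iG; apply/subsetP=> _ /imsetP[j /setD1P[ji jG] ->].
rewrite eq_sym in ji; rewrite in_setU1 inE (pairE iG) other_hit // !inE andbT.
case: (_ == other h i); rewrite ?orbF //=; apply/eqP=> e.
by have := group_holds jG; rewrite -e holds_compl other_holds.
Qed.

Let card_group h : #|group h| <= q.+2.
Proof.
have [->|/set0Pn[i iG]] := eqVneq (group h) set0; first by rewrite cards0.
rewrite -(card_excluded iG) ltnS.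
apply: leq_trans (subset_leq_card (excluded_sub iG)) _.
apply: leq_trans (leq_card_setU _ _) _; rewrite cards1.
exact: card_rest (groupA iG).
Qed.

(* If the bound is attained, the literals [other h i] come in complementary
   pairs, and two of them are both false at a third input. *)
Let card_group_strict h : 0 < q -> #|group h| <= q.+1.
Proof.
move=> q0; rewrite leqNgt; apply/negP=> big.
have partner i : i \in group h ->
    exists2 j, j \in group h & other h i = compl (other h j).
  move=> iG; case: (boolP (other h i \in excluded h i)) => [|ni].
    by case/imsetP=> j /setD1P[_ jG] ->; exists j.
  have: #|excluded h i| <= #|rest i|.
    apply: subset_leq_card; apply/subsetP=> l lE.
    have := subsetP (excluded_sub iG) l lE; rewrite in_setU1.
    by case/predU1P=> // e; rewrite -e lE in ni.
  have := card_rest (groupA iG); have := card_excluded iG; lia.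
have /card_gt0P[i iG] : 0 < #|group h| by lia.
have [i' i'G ei] := partner i iG.
(* A group of size [q.+2] has a third member because [0 < q]. *)
have [j jG /andP[ji ji']] := @exists_third _ (group h) i i' ltac:(lia).
have [j' j'G ej] := partner j jG.
have j'i : j' != i.
  apply: contraNneq ji' => j'i; apply/eqP; apply: (@other_inj h) => //.
  by apply: (@compl_inj V); rewrite -ei ej j'i complK.
have := T_holds (groupA iG) (other_hit iG j'G _).
have := T_holds (groupA iG) (other_hit iG jG _).
rewrite -ej holds_compl !(eq_sym i) ji j'i => /(_ isT) /negbTE ->.
by move=> /(_ isT).
Qed.

(** Each input other than [i] lies in the group of [compl l] for one of the at most [q.+2] literals
    [l] of [T i]; the successor accounts for [i] itself. *)
Let card_by_groups K : (forall h, #|group h| <= K) -> #|A| <= (q.+2 * K).+1.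
Proof.
move=> gK; have [->|/set0Pn[i iA]] := eqVneq A set0; first by rewrite cards0.
rewrite (cardsD1 i A) iA ltnS.
have cT : #|T i| <= q.+2.
  rewrite -(cardsID [set g i false; g i true] (T i)) -[q.+2]/(2 + q)%N leq_add //.
    apply: leq_trans (subset_leq_card (subsetIr _ _)) _.
    by rewrite cards2; case: (_ != _).
  exact: card_rest.
have /subset_leq_card/leq_trans: A :\ i \subset \bigcup_(l in T i) group (compl l).
  apply/subsetP=> j /setD1P[ji jA].
  have [b hb] := T_hits iA jA ltac:(by rewrite eq_sym).
  apply/bigcupP; exists (compl (g j b)) => //; rewrite complK inE jA.
  by case: b {hb}; rewrite eqxx ?orbT.
apply; apply: leq_trans (_ : \sum_(l in T i) #|group (compl l)| <= _).
  elim/big_rec2: _ => [|l n B _ IH]; first by rewrite cards0.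
  by apply: leq_trans (leq_card_setU _ _) _; rewrite leq_add2l.
apply: leq_trans (_ : \sum_(l in T i) K <= _); first exact: leq_sum.
by rewrite sum_nat_const leq_mul2r cT orbT.
Qed.

Lemma card_pair_system : #|A| <= (q.+2 * (if q == 0 then 2 else q.+1)).+1.
Proof.
apply: card_by_groups => h; case: eqP => [q0|/eqP q0].
  by rewrite -q0 card_group.
by apply: card_group_strict; rewrite lt0n.
Qed.

End PairCounting.

(** * The lower bound, by induction on the number of clauses *)

Section LowerBound.
Variables (V I : finType).
Implicit Types (x : I -> literal V) (phi : formula V) (A : {set I}).

Lemma card_regular A x phi : encoding A x phi -> 2 < #|A| ->
    (forall i, i \in A -> #|occ phi (compl (x i))| = 2) ->
    (forall i j C, i \in A -> j \in A -> i != j -> C \in phi ->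
       compl (x i) \in C -> compl (x j) \notin C) ->
  exists2 q, #|phi| = 2 * #|A| + q &
    #|A| <= (q.+2 * (if q == 0 then 2 else q.+1)).+1.
Proof.
move=> enc A3 occ2 excl.
pose Rs : {set clause V} := [set C in phi | [forall i in A, compl (x i) \notin C]].
exists #|Rs|.
  have cnt (C : clause V) : C \in phi ->
      1 = \sum_(i in A) (compl (x i) \in C : nat) + (C \in Rs : nat).
    move=> Cphi; rewrite !inE Cphi /=.
    case: (boolP [forall i in A, _]) => [/forall_inP H|].
      by rewrite big1 // => i iA; rewrite (negbTE (H i iA)).
    rewrite negb_forall => /existsP[i]; rewrite negb_imply negbK => /andP[iA iC].
    rewrite addn0 (bigD1 i) //= iC big1 // => j /andP[jA ji].
    by rewrite (negbTE (excl i j C _ _ _ _ _)) // eq_sym.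
  rewrite -sum1_card (eq_bigr _ cnt) big_split exchange_big /=; congr addn.
    rewrite (eq_bigr (fun=> 2)); first by rewrite sum_nat_const mulnC.
    move=> i iA; rewrite -(occ2 i iA) -sum1_card big_mkcond [RHS]big_mkcond /=.
    by apply: eq_bigr => C _; rewrite inE; case: (C \in phi) => //=.
  rewrite -sum1_card big_mkcond [RHS]big_mkcond /=.
  by apply: eq_bigr => C _; rewrite inE; case: (C \in phi) => //=; case: ifP.
(* [d.1] is a model of [phi] with [x i] true, [d.2] picks a true literal from each of the two
   clauses of [compl (x i)]; outside [A] the values are dummies. *)
have /choice[d dP] : forall i, exists d : (V -> bool) * (bool -> literal V),
    i \in A -> [/\ satisfies d.1 phi, holds d.1 (x i),
      forall b, holds d.1 (d.2 b) &
      forall C, C \in phi -> compl (x i) \in C -> exists b, d.2 b \in C].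
  move=> i; have [iA|_] := boolP (i \in A); last by exists (fun=> true, fun=> x i).
  have [a sat ai] := encoding_sat enc iA.
  have /eqP/cards2P[C1 [C2 [_ oE]]] := occ2 i iA.
  have pick C : C \in occ phi (compl (x i)) -> exists2 l, l \in C & holds a l.
    by rewrite inE => /andP[Cphi _]; have /satisfiesP := sat; apply.
  have [l1 l1C al1] := pick C1 ltac:(by rewrite oE !inE eqxx).
  have [l2 l2C al2] := pick C2 ltac:(by rewrite oE !inE eqxx orbT).
  exists (a, fun b : bool => if b then l1 else l2) => _; split=> //; first by case.
  move=> C Cphi iC; have : C \in [set C1; C2] by rewrite -oE inE Cphi.
  by rewrite !inE => /orP[]/eqP->; [exists true | exists false].
pose a i := (d i).1; pose g i := (d i).2.
have {}dP i : i \in A -> [/\ satisfies (a i) phi, holds (a i) (x i),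
    forall b, holds (a i) (g i b) &
    forall C, C \in phi -> compl (x i) \in C -> exists b, g i b \in C] := dP i.
pose T i : {set V * bool} := [set l | `[< derives phi (x i) l >] & (l != x i) &&
  [forall j in A, l != compl (x j)]].
have TP i l : l \in T i -> [/\ derives phi (x i) l, l != x i &
    forall j, j \in A -> l != compl (x j)].
  by rewrite inE => /and3P[/asboolP ? ? /forall_inP ?].
apply: (@card_pair_system V I A #|Rs| a g T).
- by move=> i b iA; have [_ _ H _] := dP i iA; apply: H.
- move=> i l iA /TP[dl _ _]; have [sat ai _ _] := dP i iA.
  exact: derives_sound sat ai dl.
- move=> i j iA jA ij.
  have [C [Cphi jC njC _ dC]] := encoding_clause enc A3 iA jA ij.
  have [sat aj agj Hg] := dP j jA; have [b bC] := Hg C Cphi jC.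
  exists b; rewrite inE; apply/and3P; split.
  + apply/asboolP; apply: dC => //.
    by apply: contraTneq (agj b) => ->; rewrite holds_compl aj.
  + apply: contraNneq (excl j i C jA iA _ Cphi jC) => [e|]; last by rewrite eq_sym.
    by rewrite -e complK.
  + apply/forall_inP => k kA; rewrite (inj_eq (@compl_inj V)).
    have [->|kj] := eqVneq k j; first by apply: contraNneq njC => <-.
    apply: contraTneq (agj b) => ->.
    by apply: (encoding_holdsN enc sat aj); rewrite // eq_sym.
- move=> i iA; have [sat ai agi Hg] := dP i iA.
  set U := T i :\: _.
  (* A clause yields at most one literal of [U], since two literals obtained from it would refute
     each other. So the image of [Rs] under [f] covers [U]; [x i] is a dummy value. *)
  pose via (C : clause V) l := (l \in C) &&
    [forall l' in C, (l' != l) ==> `[< derives phi (x i) (compl l') >]].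
  pose f (C : clause V) := odflt (x i) [pick l in U | via C l].
  apply: leq_trans (leq_imset_card f Rs); apply: subset_leq_card.
  apply/subsetP=> l lU.
  have lT : l \in T i by move: lU; rewrite inE => /andP[].
  have [dl li lN] := TP _ _ lT.
  case: (derivesP dl) => [e|[C [Cphi lC _ dC]]]; first by rewrite e eqxx in li.
  (* A negated input in [C] could only be [compl (x i)]; then [C] would contain a chosen literal of
     [i], which is true and cannot be refuted. *)
  have CR : C \in Rs.
    rewrite inE Cphi; apply/forall_inP => j jA; apply/negP=> jC.
    have dj : derives phi (x i) (x j).
      by rewrite -[x j]complK; apply: dC => //; rewrite eq_sym; apply: lN.
    have [ji|ji] := eqVneq j i; last first.
      apply: (encoding_consistent enc iA dj).
      by apply: (encoding_derives enc); rewrite // eq_sym.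
    have [b bC] := Hg C Cphi ltac:(by rewrite -ji).
    have gl : g i b != l.
      by apply: contraTneq lU => <-; rewrite !inE; case: b {bC}; rewrite eqxx ?orbT.
    have := derives_sound sat ai (dC _ bC gl).
    by rewrite holds_compl agi.
  apply/imsetP; exists C => //; rewrite /f; case: pickP => [l' |/(_ l)]; last first.
    rewrite lU /via lC /= => /negbT/negP[]; apply/forall_inP => l' l'C.
    by apply/implyP=> l'l; apply/asboolP; apply: dC.
  case/and3P=> l'U l'C _ /=; apply/eqP; apply/negPn/negP=> ll'.
  have l'T : l' \in T i by move: l'U; rewrite inE => /andP[].
  have [dl' _ _] := TP _ _ l'T.
  apply: (encoding_consistent enc iA dl'); apply: dC => //.
  by rewrite eq_sym.
Qed.

(** The second part is the square root bound after squaring; for positive [n] the truncated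
    difference cannot vanish. *)
Definition size_bound n s :=
  (n <= 8 -> 3 * n - 6 <= s) /\ (9 <= n -> n <= (s + 2 - 2 * n) ^ 2).

Lemma size_bound_leq n s s' : s <= s' -> size_bound n s -> size_bound n s'.
Proof.
move=> ss' [H1 H2]; split=> [/H1|/H2] H; first exact: leq_trans H ss'.
by apply: leq_trans H _; rewrite leq_exp2r //; lia.
Qed.

Lemma size_boundS n s : 3 <= n -> size_bound n s -> size_bound n.+1 (s + 3).
Proof.
move=> n3 [H1 H2]; split=> [n8|n9]; first by have := H1 (ltnW n8); lia.
(* From 8 to 9 inputs the closed form changes: [s + 3] is at least 21, and 21 + 2 - 18 = 5 has
   square at least 9. *)
have [n8|n8] := leqP n 8; first by have := H1 n8; rewrite -mulnn; nia.
have := H2 n8; rewrite -!mulnn.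
have -> : s + 3 + 2 - 2 * n.+1 = (s + 3 - 2 * n) by lia.
have [|] := leqP (2 * n) (s + 2); [move=> h | lia].
have -> : s + 3 - 2 * n = (s + 2 - 2 * n).+1 by lia.
by move: (s + 2 - 2 * n) => t; nia.
Qed.

(** For [n <= 8] the claim is [n <= q + 6]: the hypothesis gives [n <= 5] for [q = 0] and [n <= 7]
    for [q = 1]. For larger [n], [q.+2 * q.+1 + 1] is at most the square of [q.+2]. *)
Lemma size_bound_regular n q :
  n <= (q.+2 * (if q == 0 then 2 else q.+1)).+1 -> size_bound n (2 * n + q).
Proof.
move=> H; split=> [n8|n9].
  by case: q H => [|[|q]] /=; lia.
have -> : 2 * n + q + 2 - 2 * n = q.+2 by lia.
by rewrite -mulnn; case: q H => [|q] /=; nia.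
Qed.

(** The induction runs on [#|phi|] because [encoding_shrink] keeps the number of inputs. *)
Lemma encoding_size_bound A x phi :
  encoding A x phi -> 2 < #|A| -> size_bound #|A| #|phi|.
Proof.
have [m] := ubnP #|phi|; elim: m A x phi => // m IH A x phi /ltnSE phim enc A3.
have shrink (B : {set I}) y (psi : formula V) :
    encoding B y psi -> #|psi| < #|phi| -> 2 < #|B| -> size_bound #|B| #|psi|.
  by move=> encB lt B3; apply: (IH B y) => //; apply: leq_trans phim.
case: (pselect (exists2 i, i \in A & #|occ phi (compl (x i))| <= 1)) => [|low].
  case=> i iA o1; have [x' [phi' [enc' lt]]] := encoding_shrink enc A3 iA o1.
  by apply: (size_bound_leq (ltnW lt)); apply: shrink enc' lt A3.
have occ2 i : i \in A -> 1 < #|occ phi (compl (x i))|.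
  by move=> iA; rewrite ltnNge; apply/negP=> h; apply: low; exists i.
have phi3 := encoding_card_gt2 enc A3 occ2.
have [A4|A4] := leqP #|A| 3.
  have -> : #|A| = 3 by apply/eqP; rewrite eqn_leq A4.
  by split.
have restr j : j \in A -> 2 < #|A :\ j| /\ #|A| = #|A :\ j|.+1.
  by move=> jA; move: A4; rewrite (cardsD1 j A) jA.
have step j x' phi' : j \in A -> encoding (A :\ j) x' phi' ->
    #|phi'| + 3 <= #|phi| -> size_bound #|A| #|phi|.
  move=> jA enc' le; have [B3 ->] := restr j jA.
  apply: (size_bound_leq le); apply: size_boundS => //.
  by apply: shrink enc' _ B3; lia.
case: (pselect (exists2 i, i \in A & 2 < #|occ phi (compl (x i))|)) => [|high].
  case=> i iA o3; apply: (step _ _ _ iA (encoding_restrict enc iA)).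
  by apply: leq_trans (card_assign (compl (x i)) phi); rewrite leq_add2l.
have occE i : i \in A -> #|occ phi (compl (x i))| = 2.
  move=> iA; apply/eqP; rewrite eqn_leq occ2 // andbT leqNgt.
  by apply/negP=> h; apply: high; exists i.
case: (pselect (exists i j C, [/\ i \in A, j \in A, i != j, C \in phi &
    (compl (x i) \in C) && (compl (x j) \in C)])) => [|disj].
  case=> i [j [C [iA jA ij Cphi /andP[iC jC]]]].
  have encj := encoding_restrict enc jA; have [B3 _] := restr j jA.
  have iB : i \in A :\ j by rewrite !inE ij.
  case: (encoding_shrink encj B3 iB) => [|x' [phi' [enc' lt]]]; last first.
    apply: (step _ _ _ jA enc'); have := card_assign (compl (x j)) phi.
    by rewrite (occE j jA); lia.
  (* Making [x j] false satisfies the shared clause [C], so at most one clause with [compl (x i)]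
     remains. *)
  have : #|occ phi (compl (x i)) :\ C| = 1.
    by have := occE i iA; rewrite (cardsD1 C) inE Cphi iC => -[].
  move=> <-; apply: leq_trans (leq_imset_card (fun D => D :\ compl (compl (x j))) _).
  apply: subset_leq_card; apply/subsetP=> D; rewrite inE => /andP[/imsetP[E]].
  rewrite inE => /andP[Ephi jE] -> iE; apply/imsetP; exists E => //.
  rewrite !inE Ephi; move: iE; rewrite !inE => /andP[_ ->]; rewrite !andbT.
  by apply: contraNneq jE => ->.
have [] := card_regular enc A3 occE.
  move=> i j C iA jA ij Cphi iC; apply/negP=> jC; apply: disj.
  by exists i, j, C; rewrite iC jC.
by move=> q -> /size_bound_regular.
Qed.

End LowerBound.

Lemma P_encoding_size_bound n m (phi : formula (var n m)) :
  3 <= n -> P_encoding phi -> size_bound n #|phi|.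
Proof.
move=> n3 [_ sat ent].
have := @encoding_size_bound (var n m) 'I_n setT (fun i => pos (input m i)) phi.
rewrite cardsT card_ord; apply=> //; split=> [i _|i j _ _ ij].
  have [a /satisfiesP sata] := sat i; exists a.
    by apply/satisfiesP => C Cphi; apply: sata; rewrite inE Cphi orbT.
  by have [|l] := sata [set pos (input m i)]; rewrite !inE ?eqxx // => /eqP->.
exact: unit_entails_derives (ent i j ij).
Qed.

(** * The upper bound: the chain encoding *)

Lemma unit_entails_step (V : finType) (phi : formula V) (g l h : literal V) :
  unit_entails phi g l -> [set compl l; h] \in phi -> unit_entails phi g h.
Proof.
rewrite /unit_entails => dl Cphi.
have axC : unit_derivable (add_unit phi g) [set compl l; h].
  by apply: UD_axiom; rewrite !inE Cphi orbT.
have [lh|lh] := eqVneq (compl l) h; first by rewrite lh setUid in axC.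
suff -> : [set h] = [set compl l; h] :\ compl l.
  by apply: UD_resolve => //; rewrite !inE eqxx.
apply/setP=> t; rewrite !inE; have [->|//] := eqVneq t (compl l).
exact: negbTE.
Qed.

(* A chain encoding: [chain k] says that one of the inputs [0 .. k] is true.
   Its two ends are literals of the inputs, hence [3 (n - 2)] clauses. *)
Section Chain.
Variable p : nat.
Local Notation n := p.+3.
Let X (k : nat) : literal (var n n) := pos (input n (inord k)).
Let chain (k : nat) : literal (var n n) :=
  if k == 0 then X 0
  else if k == p.+1 then compl (X p.+2) else pos (inr (inord k)).
Let blk (kc : 'I_p.+1 * 'I_3) : clause (var n n) :=
  match val kc.2 with
  | 0 => [set compl (chain kc.1); compl (X kc.1.+1)]
  | 1 => [set compl (chain kc.1); chain kc.1.+1]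
  | _ => [set compl (X kc.1.+1); chain kc.1.+1]
  end.
Let phi : formula (var n n) := [set blk kc | kc in setT].

Let model (i : nat) (v : var n n) : bool :=
  match v with inl j => val j == i | inr k => i <= val k end.

Let model_X i k : k < n -> holds (model i) (X k) = (k == i).
Proof. by move=> kn; rewrite /holds /= inordK // eqb_id. Qed.

Let model_chain i k : i < n -> k <= p.+1 -> holds (model i) (chain k) = (i <= k).
Proof.
move=> i_n kp; rewrite /chain; have [->|k0] := eqVneq k 0.
  by rewrite model_X // leqn0 eq_sym.
have [->|kp1] := eqVneq k p.+1.
  by rewrite holds_compl model_X //; lia.
by rewrite /holds /= inordK ?eqb_id //; lia.
Qed.

Let mem_phi k c (kp : k < p.+1) (c3 : c < 3) : blk (Ordinal kp, Ordinal c3) \in phi.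
Proof. exact: imset_f. Qed.

Let wf_binary (s t : literal (var n n)) : s != compl t -> wf_clause [set s; t].
Proof.
move=> st l; rewrite !inE => /orP[]/eqP->; rewrite negb_or compl_neq ?andbT /=.
  by apply: contraNneq st => <-; rewrite complK.
by rewrite eq_sym.
Qed.

Let chain_CNF : is_CNF phi.
Proof.
move=> C /imsetP[[[k kp] [c c3]] _ ->]; rewrite /blk /=.
(* Each clause is shown to be non-tautological by a model that separates one literal from the
   complement of the other. *)
have differ i s t : holds (model i) s != holds (model i) t -> s != t.
  by apply: contraNneq => ->.
case: c c3 => [|[|c]] _; apply: wf_binary.
- apply: (differ p.+2); rewrite !holds_compl model_X ?model_chain; lia.
- apply: (differ k.+1); rewrite !holds_compl ?model_chain; lia.
- apply: (differ 0); rewrite !holds_compl ?model_X ?model_chain; lia.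
Qed.

Let chain_sat (i : 'I_n) : satisfiable (add_unit phi (pos (input n i))).
Proof.
exists (model i); apply/satisfiesP => C; rewrite !inE.
have i_n := ltn_ord i.
case/orP=> [/eqP->|/imsetP[[[k kp] [c c3]] _ ->]].
  by exists (pos (input n i)); rewrite ?inE // /holds /= eqxx.
rewrite /blk /=.
have pick2 s t : holds (model i) s || holds (model i) t ->
    exists2 l, l \in [set s; t] & holds (model i) l.
  by case/orP=> h; [exists s | exists t]; rewrite // !inE eqxx ?orbT.
case: c c3 => [|[|c]] _; apply: pick2;
  rewrite ?holds_compl ?model_X ?model_chain; lia.
Qed.

(** For [i < j] propagation climbs from link [i] to link [j.-1], which excludes input [j]; for
    [i > j] the refutation of link [i.-1] descends to link [j]. The last input is the complement of
    the top link, so it skips the clause next to it. *)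
Let chain_entails (i j : 'I_n) : i != j ->
  unit_entails phi (pos (input n i)) (neg (input n j)).
Proof.
move=> ij; set g := pos (input n i).
have start : unit_entails phi g g by apply: UD_axiom; rewrite !inE eqxx.
have gE : g = X i by rewrite /X inord_val.
have hE : neg (input n j) = compl (X j) by rewrite /X inord_val.
have ub (s t : literal (var n n)) : unit_entails phi g (compl t) ->
    [set s; t] \in phi -> unit_entails phi g s.
  by move=> d C; apply: unit_entails_step d _; rewrite complK setUC.
have c1 k : k <= p -> [set compl (chain k); compl (X k.+1)] \in phi.
  by move=> kp; have := @mem_phi k 0 kp isT.
have c2 k : k <= p -> [set compl (chain k); chain k.+1] \in phi.
  by move=> kp; have := @mem_phi k 1 kp isT.
have c3 k : k <= p -> [set compl (X k.+1); chain k.+1] \in phi.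
  by move=> kp; have := @mem_phi k 2 kp isT.
have up k d : k + d <= p.+1 -> unit_entails phi g (chain k) ->
    unit_entails phi g (chain (k + d)).
  elim: d => [|d IH] kd H; first by rewrite addn0.
  rewrite addnS in kd *.
  by apply: unit_entails_step (c2 _ _) => //; apply: IH => //; apply: ltnW.
have down k d : k + d <= p.+1 -> unit_entails phi g (compl (chain (k + d))) ->
    unit_entails phi g (compl (chain k)).
  elim: d => [|d IH] kd H; first by rewrite addn0 in H.
  rewrite addnS in kd H; apply: IH; first exact: ltnW.
  by apply: ub H (c2 _ _).
have upX k : k <= p.+1 -> unit_entails phi g (X k) -> unit_entails phi g (chain k).
  by case: k => [//|k] kp H; apply: unit_entails_step H (c3 _ _).
have downX k : k <= p.+1 -> unit_entails phi g (compl (chain k)) ->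
    unit_entails phi g (compl (X k)).
  by case: k => [//|k] kp H; apply: ub H (c3 _ _).
have top : chain p.+1 = compl (X p.+2) by rewrite /chain eqxx.
have i_n := ltn_ord i; have j_n := ltn_ord j; rewrite hE.
have [lt|gt|e] := ltngtP (nat_of_ord i) (nat_of_ord j);
  last by rewrite (val_inj e) eqxx in ij.
  have ci : unit_entails phi g (chain i) by apply: upX; rewrite -?gE //; lia.
  have [jl|jl] := eqVneq (nat_of_ord j) p.+2.
    have := up i (p.+1 - i) _ ci; rewrite subnKC; last by lia.
    by rewrite jl -top; apply.
  have -> : nat_of_ord j = (i + (j.-1 - i)).+1 by rewrite /=; lia.
  apply: unit_entails_step (c1 _ _); last by lia.
  by apply: up => //; lia.
apply: downX; first by lia.
have [il|il] := eqVneq (nat_of_ord i) p.+2.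
  have e : chain p.+1 = compl g by rewrite top gE il.
  apply: (@down j (p.+1 - j)); first by lia.
  by rewrite subnKC; [rewrite e complK | lia].
apply: (@down j (i.-1 - j)); first by lia.
have -> : j + (i.-1 - j) = i.-1 by rewrite /=; lia.
apply: (ub _ (compl (X i.-1.+1))); last by apply: c1; lia.
by rewrite complK prednK -?gE //; lia.
Qed.

Lemma min_P_size_le : min_P_size p.+3 <= 3 * p.+3 - 6.
Proof.
rewrite /min_P_size; case: ex_minnP => s _ /(_ #|phi|) H.
apply: leq_trans (H _) _.
  by apply/asboolP; exists n, phi; split=> //; split.
apply: leq_trans (leq_imset_card _ _) _.
by rewrite cardsT card_prod !card_ord; lia.
Qed.

End Chain.

(** * The bounds over the reals *)

Local Open Scope ring_scope.

Theorem theorem3 (R : realType) (n : nat) (hn : (3 <= n)%N) :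
  ((n <= 8)%N -> min_P_size n = (3 * n - 6)%N) /\
  ((9 <= n)%N -> 2 * n%:R + Num.sqrt n%:R - 2 <= (min_P_size n)%:R :> R).
Proof.
have [low high] : size_bound n (min_P_size n).
  rewrite /min_P_size; case: ex_minnP => s /asboolP[m [phi [enc <-]]] _.
  exact: P_encoding_size_bound.
split=> [n8|n9].
  apply/eqP; rewrite eqn_leq low // andbT.
  by case: n hn {low high n8} => [|[|[|p]]] // _; apply: min_P_size_le.
have := high n9; set s := min_P_size n => le.
(* Otherwise the truncated difference is 0, contradicting [9 <= n]. *)
have ge : (2 * n <= s + 2)%N.
  by rewrite leqNgt; apply/negP=> h; move: le; rewrite (_ : _ - _ = 0)%N //; lia.
have -> : s%:R = (s + 2 - 2 * n)%:R + 2 * n%:R - 2 :> R.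
  by rewrite -natrM -natrD subnK // natrD addrK.
rewrite lerB // addrC lerD //.
rewrite -(ler_pXn2r (n := 2)) ?nnegrE ?sqrtr_ge0 ?ler0n //.
by rewrite sqr_sqrtr ?ler0n // -natrX ler_nat.
Qed.
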